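(* Let $\mathcal{H}$ be an infinite-dimensional separable real Hilbert space, let $\mu^{f}=\mathcal{N}(m^{f},\mathrm{P}^{f})$ be a ($\sigma$-additive) Gaussian probability measure on the Borel sets of $\mathcal{H}$ with mean $m^{f}\in\mathcal{H}$ and covariance operator $\mathrm{P}^{f}$, and let $\mathrm{R}$ be a bounded, symmetric, positive semidefinite linear operator on $\mathcal{H}$. Assume that $\mathrm{P}^{f}$ and $\mathrm{R}$ commute, i.e. $\mathrm{P}^{f}\mathrm{R}-\mathrm{R}\mathrm{P}^{f}=0$. Then $$\int_{\mathcal{H}}\exp\left(-\tfrac{1}{2}|y-x|_{\mathrm{R}^{-1}}^{2}\right)d\mu^{f}(x)>0\quad\text{for all }y\in\mathcal{H}$$ if and only if the operator $\mathrm{R}$ has positive lower bound.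
   Context: The inner product on $\mathcal{H}$ is $\langle\cdot,\cdot\rangle$ and the norm is $|u|=\sqrt{\langle u,u\rangle}$. A bounded linear operator $\mathrm{R}$ on $\mathcal{H}$ has positive lower bound if there is $\alpha>0$ such that $\langle\mathrm{R}u,u\rangle\ge\alpha|u|^{2}$ for all $u\in\mathcal{H}$. The covariance $\mathrm{P}^{f}$ of a $\sigma$-additive Gaussian measure on $\mathcal{H}$ is symmetric, positive semidefinite and trace class; $\mathrm{R}$ (the data error covariance) is not required to be trace class. With $\mathrm{R}^{1/2}$ the positive semidefinite square root of $\mathrm{R}$ and $\mathrm{R}^{1/2}(\mathcal{H})$ its image, $$|x|_{\mathrm{R}^{-1}}^{2}=\begin{cases}\langle\mathrm{R}^{-1/2}x,\mathrm{R}^{-1/2}x\rangle & \text{if }x\in\mathrm{R}^{1/2}(\mathcal{H}),\\ \infty & \text{if }x\notin\mathrm{R}^{1/2}(\mathcal{H}),\end{cases}$$ and $\exp(-\infty)=0$ by convention. For $x\in\mathrm{R}^{1/2}(\mathcal{H})$, $\mathrm{R}^{-1/2}x$ denotes the preimage of $x$ under $\mathrm{R}^{1/2}$ (the one of minimal norm, if $\mathrm{R}$ is not injective). *)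

(* Defs.v *)
From mathcomp Require Import all_boot all_order all_algebra sesquilinear.
From mathcomp Require Import all_classical all_reals all_analysis.

Set Implicit Arguments.
Unset Strict Implicit.
Unset Printing Implicit Defensive.

Import Order.TTheory GRing.Theory Num.Theory.
Import numFieldNormedType.Exports.

Local Open Scope classical_set_scope.
Local Open Scope ring_scope.

Section HilbertSpace.
Context {K : realType}.

(* A real Hilbert space is a complete normed module over the reals with an
   inner product (a positive definite symmetric bilinear form) inducing its
   norm. *)
Definition norm_from_inner (H : normedModType K) (dot : {dot H for idfun}) :=
  forall u : H, `|u| = Num.sqrt (dot u u).

Definition separable (H : topologicalType) :=
  exists D : set H, countable D /\ dense D.

Definition infinite_dimensional (H : lmodType K) :=
  forall (n : nat) (e : 'I_n -> H),
    ~ (forall x : H, exists c : 'I_n -> K, x = \sum_(i < n) c i *: e i).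

Section Operators.
Context {H : normedModType K} (dot : {dot H for idfun}).

Definition symmetric_operator (A : H -> H) :=
  forall u v : H, dot (A u) v = dot u (A v).

Definition positive_semidefinite (A : H -> H) :=
  forall u : H, 0 <= dot (A u) u.

Definition positive_lower_bound (A : H -> H) :=
  exists2 alpha : K, 0 < alpha & forall u : H, alpha * `|u| ^+ 2 <= dot (A u) u.

(* The value [cst 0] is a dummy: a bounded symmetric positive semidefinite
   operator on a Hilbert space has exactly one such square root. *)
Definition operator_sqrt (A : H -> H) : H -> H :=
  xget (cst 0) [set S : H -> H |
    [/\ linear S, bounded_fun_norm S, symmetric_operator S,
        positive_semidefinite S & forall x, S (S x) = A x]].

(* The preimage of minimal norm of [x] under the square root of [A]; dummy
   value 0 when [x] is not in the range. *)
Definition operator_invsqrt (A : H -> H) (x : H) : H :=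
  xget 0 [set z : H | operator_sqrt A z = x /\
    forall w : H, operator_sqrt A w = x -> `|z| <= `|w|].

Definition weighted_sqnorm (A : H -> H) (x : H) : \bar K :=
  if x \in range (operator_sqrt A)
  then (dot (operator_invsqrt A x) (operator_invsqrt A x))%:E
  else +oo%E.

End Operators.

Definition borel (H : normedModType K) : measurableType (@open H).-sigma :=
  g_sigma_algebraType (@open H).

(* [s] is the standard deviation. The case [s = 0] is separate because
   [normal_prob m 0] is the uniform law on [0, 1]. *)
Definition normal_law (m s : K) (A : set K) : \bar K :=
  if s == 0 then \d_m A else normal_prob m s A.

Section GaussianMeasure.
Context {H : normedModType K} (dot : {dot H for idfun}).
Variable mu : probability (borel H) K.

(* By Riesz representation, the maps [dot u] are the continuous linear
   functionals. *)
Definition gaussian_measure :=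
  forall u : H, exists a s : K, 0 <= s /\
    forall A : set K, measurable A ->
      pushforward mu (dot u) A = normal_law a s A.

Definition has_mean (m : H) :=
  forall u : H, ('E_mu[dot u] = (dot u m)%:E)%E.

Definition has_covariance (P : H -> H) :=
  forall u v : H, covariance mu (dot u) (dot v) = (dot (P u) v)%:E.

Definition is_gaussian (m : H) (P : H -> H) :=
  [/\ gaussian_measure, has_mean m & has_covariance P].

End GaussianMeasure.
End HilbertSpace.

(* Main.v *)
Require Import Defs.
From HB Require Import structures.
From mathcomp Require Import all_boot all_order all_algebra sesquilinear.
From mathcomp Require Import finmap all_classical all_reals all_analysis.
From mathcomp Require Import ring lra.
Set Implicit Arguments.
Unset Strict Implicit.
Unset Printing Implicit Defensive.
Import Order.TTheory GRing.Theory Num.Theory.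
Import numFieldNormedType.Exports.
Local Open Scope classical_set_scope.
Local Open Scope ring_scope.

(** Write [S] for the square root of [R]. The integrand at [y] is positive exactly
at the points [x] of [y + range S] and vanishes elsewhere, so the integral at
[y] is positive when, and only when, the coset [y + range S] carries mass of
the measure.

If the integral is positive for all [y], all cosets of the subspace [range S]
carry mass. Distinct cosets are disjoint, and a probability measure cannot
charge uncountably many disjoint sets; but if some [v] lies outside [range S]
the cosets of the points [t *: v], with [t] real, are pairwise distinct. So [S] is
onto ([countable_disjoint_pos], [uncountable_real]). A symmetric surjective
operator is bounded below, by the uniform boundedness principle applied to the
functionals [dot v] with [`|S v| <= 1], and [dot (R u) u = `|S u| ^+ 2] turns
this into a positive lower bound for [R] ([surjective_positive_lower_bound]).

Conversely, if [R] is bounded below by [a], then [R] is onto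
([positive_lower_bound_surjective]), hence so is [S], and the weighted square
norm of [x] is at most [a^-1 * `|x| ^+ 2]. The integrand is then bounded away
from 0 on each ball, and some ball has positive measure.

The existence of [S] is proved by an iteration ([operator_sqrtP]). The integral
of a nonnegative function is a supremum over the simple functions below it, and
both directions compare the integrand with such functions directly
([integral_gt0_exists_set], [integral_gt0]). *)

(** * Symmetric positive semidefinite operators *)

Section InnerProduct.
Context {K : realType} {H : normedModType K} (dot : {dot H for idfun}).
Hypothesis Hnorm : norm_from_inner dot.

Lemma dotC u v : dot u v = dot v u.
Proof. by rewrite (hermC dot) expr0 mul1r. Qed.

Lemma dotDl u v w : dot (u + v) w = dot u w + dot v w.
Proof. exact: linearDl. Qed.

Lemma dotZl a u w : dot (a *: u) w = a * dot u w.
Proof. exact: linearZl_LR. Qed.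

Lemma dotDr u v w : dot w (u + v) = dot w u + dot w v.
Proof. by rewrite dotC dotDl !(dotC w). Qed.

Lemma dotZr a u w : dot w (a *: u) = a * dot w u.
Proof. by rewrite dotC dotZl (dotC w). Qed.

Lemma dotBl u v w : dot (u - v) w = dot u w - dot v w.
Proof. by rewrite -scaleN1r dotDl dotZl mulN1r. Qed.

Lemma dotBr u v w : dot w (u - v) = dot w u - dot w v.
Proof. by rewrite dotC dotBl !(dotC w). Qed.

Lemma dot_ge0 u : 0 <= dot u u.
Proof.
have [->|u0] := eqVneq u 0; last exact/ltW/neq0_dnorm_gt0.
by rewrite -(scale0r (0 : H)) dotZl mul0r.
Qed.

Lemma sqr_norm u : `|u| ^+ 2 = dot u u.
Proof. by rewrite Hnorm sqr_sqrtr// dot_ge0. Qed.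

(** The Cauchy-Schwarz inequality for the semidefinite form [dot (A u) v]. The
form may be degenerate, which is why the case [dot (A v) v = 0] is separate. *)
Lemma psd_CauchySchwarz (A : {linear H -> H}) u v :
  symmetric_operator dot A -> positive_semidefinite dot A ->
  dot (A u) v ^+ 2 <= dot (A u) u * dot (A v) v.
Proof.
move=> As Ap; set a := dot _ u; set b := dot _ v; set c := dot _ v.
have q t : 0 <= a + 2 * t * b + t ^+ 2 * c.
  have := Ap (u + t *: v).
  rewrite linearD linearZ /= !(dotDl, dotDr, dotZl, dotZr).
  rewrite (As v u) (dotC v (A u)) -/a -/b -/c => h; apply: le_trans h _.
  by lra.
have a0 : 0 <= a := Ap u.
have := Ap v; rewrite -/c le0r => /orP[/eqP c0|c_gt0].
  have [->|b0] := eqVneq b 0; first by rewrite c0 expr0n /= mulr0.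
  (* When [c = 0] the polynomial [a + 2 t b] is affine; this [t] gives it the
     value -1. *)
  have := q (- (a + 1) / (2 * b)); rewrite c0 mulr0 addr0.
  have -> : a + 2 * (- (a + 1) / (2 * b)) * b = -1 by field.
  by lra.
(* The minimum of the quadratic polynomial. *)
have := q (- b / c).
have -> : a + 2 * (- b / c) * b + (- b / c) ^+ 2 * c = (a * c - b ^+ 2) / c.
  by field; rewrite gt_eqF.
by rewrite pmulr_lge0 ?invr_gt0// subr_ge0.
Qed.

Lemma dot_le_norm u v : `|dot u v| <= `|u| * `|v|.
Proof.
have := @psd_CauchySchwarz idfun u v (fun _ _ => erefl) dot_ge0.
by rewrite /= -!sqr_norm -exprMn -real_normK ?num_real// ler_pXn2r// nnegrE mulr_ge0.
Qed.

Lemma bounded_operatorP (A : {linear H -> H}) : bounded_fun_norm A <->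
  exists2 M : K, 0 < M & forall x, `|A x| <= M * `|x|.
Proof.
split=> [/(_ 1)[M AM]|[M M0 AM] r]; last first.
  by exists (M * r) => x xr; rewrite (le_trans (AM x))// ler_pM2l.
exists (`|M| + 1) => [|x]; first by rewrite ltr_wpDl.
have [->|x0] := eqVneq x 0; first by rewrite linear0 !normr0 mulr0.
have := AM (`|x|^-1 *: x).
rewrite normrZ normfV normr_id mulVf ?normr_eq0// => /(_ (lexx _)).
rewrite linearZ /= normrZ normfV normr_id ler_pdivrMl ?normr_gt0// mulrC.
move=> /le_trans; apply; rewrite ler_pM2r ?normr_gt0//.
by rewrite (le_trans (ler_norm _))// lerDl.
Qed.

(** The operator inequality [A ^ 2 <= M A]: Cauchy-Schwarz for the form of [A],
applied to [u] and [A u], leaves one factor [`|A u| ^+ 2] to cancel. *)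
Lemma psd_sqr_norm_le (A : {linear H -> H}) M u :
  symmetric_operator dot A -> positive_semidefinite dot A ->
  (forall x, `|A x| <= M * `|x|) -> `|A u| ^+ 2 <= M * dot (A u) u.
Proof.
move=> As Ap AM.
have [->|Au0] := eqVneq (A u) 0.
  by rewrite normr0 expr0n /= -(scale0r (0 : H)) dotZl mul0r mulr0.
have := psd_CauchySchwarz u (A u) As Ap; rewrite -sqr_norm => CS.
have N0 : 0 < `|A u| ^+ 2 by rewrite exprn_gt0// normr_gt0.
have : dot (A (A u)) (A u) <= M * `|A u| ^+ 2.
  apply: le_trans (ler_norm _) _; apply: le_trans (dot_le_norm _ _) _.
  by rewrite expr2 mulrA ler_wpM2r.
move=> /(ler_wpM2l (Ap u)) /(le_trans CS).
by rewrite mulrA expr2 ler_pM2r// mulrC.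
Qed.

(** With the step [M^-1], the quadratic term of the expanded square is absorbed
by half of the linear one. This one estimate makes [1 - M^-1 A] a nonexpansive
operator, to which the square root iteration applies, and a strict contraction
when [A] has a positive lower bound. *)
Lemma id_sub_psd_norm_le (A : {linear H -> H}) M u : 0 < M ->
  symmetric_operator dot A -> positive_semidefinite dot A ->
  (forall x, `|A x| <= M * `|x|) ->
  `|u - M^-1 *: A u| ^+ 2 <= `|u| ^+ 2 - M^-1 * dot (A u) u.
Proof.
move=> M0 As Ap AM; have := psd_sqr_norm_le u As Ap AM.
rewrite 2!sqr_norm !(dotBl, dotBr, dotZl, dotZr) (dotC u (A u)) -!sqr_norm.
move=> h; have : M^-1 * (M^-1 * `|A u| ^+ 2) <= M^-1 * dot (A u) u.
  by rewrite ler_pM2l ?invr_gt0// ler_pdivrMl.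
lra.
Qed.

End InnerProduct.

(** * The square root of a bounded positive operator *)

Section SquareRoot.
Context {K : realType} {H : completeNormedModType K} (dot : {dot H for idfun}).
Hypothesis Hnorm : norm_from_inner dot.

Section Iteration.
Variable A : {linear H -> H}.
Hypothesis Asym : symmetric_operator dot A.
Hypothesis A_le1 : forall x, `|A x| <= `|x|.

(** The solution [Z] of [Z = (A + Z ^ 2) / 2] satisfies [(1 - Z) ^ 2 = 1 - A]. It
is reached by iterating this equation from 0; the [sqrt_iter n] are polynomials
in [A], so they commute. *)
Fixpoint sqrt_iter n : {linear H -> H} :=
  if n is m.+1 then 2^-1 \*: (A \+ (sqrt_iter m \o sqrt_iter m)) else \0.

(** The same iteration for the real number 1 in place of [A]. Its increments
dominate those of [sqrt_iter] in operator norm, and it increases and stays below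
1, so that it gives the rate of convergence for free. *)
Fixpoint sqrt_gauge n : K :=
  if n is m.+1 then 2^-1 * (1 + sqrt_gauge m ^+ 2) else 0.

Notation Y := sqrt_iter.
Notation t := sqrt_gauge.

Lemma sqrt_iterS n x : Y n.+1 x = 2^-1 *: (A x + Y n (Y n x)).
Proof. by []. Qed.

Lemma sqrt_gaugeS n : t n.+1 = 2^-1 * (1 + t n ^+ 2).
Proof. by []. Qed.

Lemma sqrt_gauge_ge0_le1 n : 0 <= t n <= 1.
Proof.
elim: n => [|n /andP[t0 t1]] /=; first by rewrite lexx ler01.
have := exprn_ile1 2 t0 t1; have := exprn_ge0 2 t0; lra.
Qed.

Lemma sqrt_gauge_le_succ n : t n <= t n.+1.
Proof. by have /= := sqr_ge0 (1 - t n); rewrite sqrrB; lra. Qed.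

Lemma sqrt_gauge_nd : {homo t : m n / (m <= n)%N >-> m <= n}.
Proof. exact/nondecreasing_seqP/sqrt_gauge_le_succ. Qed.

Lemma cvg_sqrt_gauge : cvgn t.
Proof.
apply: nondecreasing_is_cvgn; first exact: sqrt_gauge_nd.
by exists 1 => _ [n _ <-]; have /andP[] := sqrt_gauge_ge0_le1 n.
Qed.

Lemma sqrt_iter_comm (B : {linear H -> H}) n :
  (forall x, A (B x) = B (A x)) -> forall x, Y n (B x) = B (Y n x).
Proof.
move=> AB; elim: n => [|n IH] x; first by rewrite /= linear0.
by rewrite !sqrt_iterS AB !IH -linearD -linearZ.
Qed.

Lemma sqrt_iter_comm_iter m n x : Y m (Y n x) = Y n (Y m x).
Proof. by apply: sqrt_iter_comm => y; rewrite (sqrt_iter_comm n (B := A)). Qed.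

Lemma sqrt_iter_sym n : symmetric_operator dot (Y n).
Proof.
elim: n => [|n IH] u v; first by rewrite /= -(scale0r (0 : H)) dotZl dotZr !mul0r.
by rewrite !sqrt_iterS dotZl dotZr dotDl dotDr Asym !IH.
Qed.

Lemma sqrt_iter_le n x : `|Y n x| <= t n * `|x|.
Proof.
elim: n x => [|n IH] x; first by rewrite /= normr0 mul0r.
rewrite sqrt_iterS normrZ /= gtr0_norm ?invr_gt0// -mulrA ler_pM2l ?invr_gt0//.
rewrite (le_trans (ler_normD _ _))// mulrDl mul1r lerD// expr2 -mulrA.
rewrite (le_trans (IH _))// ler_wpM2l//.
by have /andP[] := sqrt_gauge_ge0_le1 n.
Qed.

(** For commuting [Y] and [Y'], [Y' ^ 2 - Y ^ 2 = (Y' - Y)(Y' + Y)]: the increment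
at step [n.+1] is bounded by half the increment at step [n] times the sum of the
norms, which is the recursion that the gauge satisfies with equality. *)
Lemma sqrt_iter_dist_succ n x :
  `|Y n.+1 x - Y n x| <= (t n.+1 - t n) * `|x|.
Proof.
elim: n x => [|n IH] x.
  rewrite sqrt_iterS /= subr0 addr0 expr0n /= addr0 mulr1 subr0 normrZ.
  by rewrite gtr0_norm ?invr_gt0// ler_pM2l// invr_gt0.
rewrite (sqrt_iterS n.+1) (sqrt_iterS n) -scalerBr opprD addrACA subrr add0r.
have -> : Y n.+1 (Y n.+1 x) - Y n (Y n x) =
    Y n.+1 (Y n.+1 x + Y n x) - Y n (Y n.+1 x + Y n x).
  rewrite (linearD (Y n.+1)) (linearD (Y n)) [Y n (Y n.+1 x)]sqrt_iter_comm_iter.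
  by rewrite opprD addrA addrK.
rewrite normrZ gtr0_norm ?invr_gt0//.
have -> : t n.+2 - t n.+1 = 2^-1 * ((t n.+1 - t n) * (t n.+1 + t n)).
  by rewrite (sqrt_gaugeS n.+1) [X in _ - X = _]sqrt_gaugeS; ring.
rewrite -mulrA ler_pM2l ?invr_gt0//; apply: le_trans (IH _) _.
rewrite -mulrA ler_wpM2l ?subr_ge0 ?sqrt_gauge_le_succ//.
by rewrite (le_trans (ler_normD _ _))// mulrDl lerD// sqrt_iter_le.
Qed.

Lemma sqrt_iter_dist m n x : (m <= n)%N ->
  `|Y n x - Y m x| <= (t n - t m) * `|x|.
Proof.
elim: n => [|n IH]; first by rewrite leqn0 => /eqP ->; rewrite !subrr normr0 mul0r.
rewrite leq_eqVlt => /predU1P[->|mn]; first by rewrite !subrr normr0 mul0r.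
have -> : Y n.+1 x - Y m x = (Y n.+1 x - Y n x) + (Y n x - Y m x).
  by rewrite addrA subrK.
rewrite (le_trans (ler_normD _ _))//.
apply: le_trans (lerD (sqrt_iter_dist_succ _ _) (IH mn)) _.
by rewrite -mulrDl addrA subrK.
Qed.

Definition sqrt_err n : K := limn t - t n.

Lemma sqrt_err_ge n p : t p - t n <= sqrt_err n.
Proof.
by rewrite lerB// nondecreasing_cvgn_le//; [exact: sqrt_gauge_nd|exact: cvg_sqrt_gauge].
Qed.

Lemma sqrt_err_ge0 n : 0 <= sqrt_err n.
Proof. by rewrite -(subrr (t n)) sqrt_err_ge. Qed.

(** This holds because [sqrt_err] tends to 0. The algebraic properties of the
iterates pass to the limit operator through this lemma, applied to the norm of
the difference of the two sides. *)
Lemma sqrt_err_squeeze (a c : K) : (forall n, a <= c * sqrt_err n) -> a <= 0.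
Proof.
move=> h; have e0 : c * sqrt_err n @[n --> \oo] --> (0 : K).
  rewrite -(mulr0 c) -(subrr (limn t)); apply: cvgMr; apply: cvgB.
    exact: cvg_cst.
  exact: cvg_sqrt_gauge.
rewrite -(cvg_lim _ e0)//; apply: limr_ge; first by apply/cvg_ex; exists 0.
exact: nearW.
Qed.

Lemma sqrt_iter_limit : exists Z : H -> H,
  forall n x, `|Z x - Y n x| <= sqrt_err n * `|x|.
Proof.
have cvgY x : cvgn (fun n => Y n x).
  apply/cauchy_cvgP/cauchyP => e e0.
  have x1 : 0 < `|x| + 1 by rewrite ltr_wpDl.
  have /cvgrPdist_lt/(_ (e / (`|x| + 1))) := cvg_sqrt_gauge.
  rewrite divr_gt0// => /(_ isT)[N _ tN].
  exists (Y N x); exists N => // n /= Nn; rewrite -ball_normE /= distrC.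
  apply: le_lt_trans (sqrt_iter_dist x Nn) _.
  have := tN N (leqnn N); rewrite /= -/(sqrt_err N) ger0_norm ?sqrt_err_ge0//.
  rewrite ltr_pdivlMr// => /(le_lt_trans _); apply.
  apply: ler_pM => //; first by rewrite subr_ge0 sqrt_gauge_nd.
    exact: sqrt_err_ge.
  by rewrite lerDl.
exists (fun x => limn (fun n => Y n x)) => n x.
have h : `|Y p x - Y n x| @[p --> \oo] --> `|limn (fun n => Y n x) - Y n x|.
  by apply: cvg_norm; apply: cvgB; [exact: cvgY|exact: cvg_cst].
rewrite -(cvg_lim _ h)//; apply: limr_le; first by apply/cvg_ex; eexists; exact: h.
exists n => // p /= np; apply: le_trans (sqrt_iter_dist x np) _.
by rewrite ler_wpM2r// sqrt_err_ge.
Qed.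

(** The square root is [1 - Z], with [Z] the limit of the iterates. It is
positive because [Z] is nonexpansive. *)
Lemma sqrt_of_id_sub : exists S : H -> H,
  [/\ linear S, bounded_fun_norm S, symmetric_operator dot S,
      positive_semidefinite dot S & forall x, S (S x) = x - A x].
Proof.
have [Z ZY] := sqrt_iter_limit.
have eqZ c (u v : H) : (forall n, `|u - v| <= c * sqrt_err n) -> u = v.
  move=> h; apply/subr0_eq/normr0_eq0/le_anti.
  by rewrite (sqrt_err_squeeze h) normr_ge0.
have Zlin : linear Z.
  move=> a u v; apply: (eqZ (`|a *: u + v| + (`|a| * `|u| + `|v|))) => n.
  (* Each identity for [Z] is written as a combination of the errors [Z - Y n],
     using that [Y n] satisfies it exactly. *)
  have -> : Z (a *: u + v) - (a *: Z u + Z v) = (Z (a *: u + v) - Y n (a *: u + v)) -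
      (a *: (Z u - Y n u) + (Z v - Y n v)).
    by rewrite linearP scalerBr addrACA -opprD opprB addrA subrK.
  apply: le_trans (ler_normB _ _) _; rewrite mulrDl lerD//.
    by rewrite mulrC ZY.
  apply: le_trans (ler_normD _ _) _; rewrite mulrDl lerD//.
    by rewrite normrZ -mulrA ler_wpM2l// mulrC ZY.
  by rewrite mulrC ZY.
have Zle x : `|Z x| <= `|x|.
  rewrite -subr_le0; apply: (sqrt_err_squeeze (c := `|x|)) => n.
  rewrite lerBlDr -(subrK (Y n x) (Z x)) (le_trans (ler_normD _ _))//.
  rewrite lerD//; first by rewrite mulrC ZY.
  rewrite (le_trans (sqrt_iter_le _ _))// ler_piMl//.
  by have /andP[] := sqrt_gauge_ge0_le1 n.
have Zsym : symmetric_operator dot Z.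
  move=> u v; apply/subr0_eq/normr0_eq0/le_anti; rewrite normr_ge0 andbT.
  apply: (sqrt_err_squeeze (c := 2 * (`|u| * `|v|))) => n.
  have -> : dot (Z u) v - dot u (Z v) =
      dot (Z u - Y n u) v - dot u (Z v - Y n v).
    by rewrite dotBl dotBr (sqrt_iter_sym n u v); ring.
  apply: le_trans (ler_normB _ _) _; rewrite mulr2n !mulrDl !mul1r lerD//.
    by rewrite (le_trans (dot_le_norm Hnorm _ _))// mulrAC ler_wpM2r// mulrC ZY.
  by rewrite (le_trans (dot_le_norm Hnorm _ _))// -mulrA ler_wpM2l// mulrC ZY.
have ZZ x : Z (Z x) + A x = 2 *: Z x.
  apply: (eqZ (4 * `|x|)) => n.
  have -> : Z (Z x) + A x - 2 *: Z x = (Z (Z x) - Y n (Z x)) +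
      Y n (Z x - Y n x) - 2 *: (Z x - Y n.+1 x).
    rewrite scalerBr sqrt_iterS scalerA mulfV// scale1r linearB /=.
    rewrite [_ - Y n (Z x) + _]addrA subrK opprB (addrC (A x) (Y n _)).
    by rewrite [RHS]addrA [_ + (Y n _ + _)]addrA subrK.
  apply: le_trans (ler_normB _ _) _; rewrite -mulrA.
  have e_le : sqrt_err n.+1 <= sqrt_err n by rewrite lerB// sqrt_gauge_le_succ.
  have h1 : `|Z (Z x) - Y n (Z x)| <= sqrt_err n * `|x|.
    by rewrite (le_trans (ZY _ _))// ler_wpM2l// sqrt_err_ge0.
  have h2 : `|Y n (Z x - Y n x)| <= sqrt_err n * `|x|.
    rewrite (le_trans (sqrt_iter_le _ _))// (le_trans _ (ZY n x))// ler_piMl//.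
    by have /andP[] := sqrt_gauge_ge0_le1 n.
  have h3 : `|2 *: (Z x - Y n.+1 x)| <= 2 * (sqrt_err n * `|x|).
    by rewrite normrZ gtr0_norm// ler_pM2l// (le_trans (ZY _ _))// ler_wpM2r.
  have := ler_normD (Z (Z x) - Y n (Z x)) (Y n (Z x - Y n x)).
  by rewrite (mulrC `|x|); lra.
exists (fun x => x - Z x); split.
- by move=> a u v; rewrite Zlin scalerBr opprD addrACA.
- move=> r; exists (2 * r) => x xr; rewrite (le_trans (ler_normB _ _))//.
  by rewrite mulr2n mulrDl mul1r lerD// (le_trans (Zle x)).
- by move=> u v; rewrite dotBl dotBr Zsym.
- move=> u; rewrite dotBl subr_ge0 -(sqr_norm Hnorm).
  rewrite (le_trans (ler_norm _))// (le_trans (dot_le_norm Hnorm _ _))//.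
  by rewrite expr2 ler_wpM2r.
- move=> x.
  have ZB : Z (x - Z x) = Z x - Z (Z x).
    by have := Zlin (-1) (Z x) x; rewrite !scaleN1r [- Z x + x]addrC [- Z (Z x) + _]addrC.
  have -> : A x = 2 *: Z x - Z (Z x) by rewrite -ZZ addrC addKr.
  by rewrite ZB scaler_nat mulr2n !opprB opprD addrACA -addrA.
Qed.

End Iteration.
Section Operator.
Variable R : {linear H -> H}.
Hypothesis Rbnd : bounded_fun_norm R.
Hypothesis Rsym : symmetric_operator dot R.
Hypothesis Rpsd : positive_semidefinite dot R.

(** It suffices to exhibit one square root. With [M] a bound for [R], the operator
[1 - M^-1 R] is nonexpansive, so [M^-1 R] has a square root, which is rescaled
by [sqrt M]. *)
Lemma operator_sqrtP :
  [/\ linear (operator_sqrt dot R), bounded_fun_norm (operator_sqrt dot R),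
      symmetric_operator dot (operator_sqrt dot R),
      positive_semidefinite dot (operator_sqrt dot R)
    & forall x, operator_sqrt dot R (operator_sqrt dot R x) = R x].
Proof.
have [M M0 RM] := (bounded_operatorP R).1 Rbnd.
pose A : {linear H -> H} := idfun \- (M^-1 \*: R).
have Asym : symmetric_operator dot A.
  by move=> u v; rewrite /= dotBl dotBr dotZl dotZr Rsym.
have A_le1 x : `|A x| <= `|x|.
  rewrite -(@ler_pXn2r _ 2)// ?nnegrE//.
  apply: le_trans (id_sub_psd_norm_le Hnorm x M0 Rsym Rpsd RM) _.
  by rewrite gerDl oppr_le0 mulr_ge0 ?invr_ge0 ?Rpsd// ltW.
have [S [Slin Sbnd Ssym Spsd SS]] := sqrt_of_id_sub Asym A_le1.
suff ex : exists S : H -> H, [/\ linear S, bounded_fun_norm S,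
    symmetric_operator dot S, positive_semidefinite dot S
  & forall x, S (S x) = R x] by exact: xgetPex ex.
exists (fun x => Num.sqrt M *: S x); split.
- by move=> a u v; rewrite Slin scalerDr !scalerA mulrC.
- move=> r; have [B SB] := Sbnd r; exists (Num.sqrt M * B) => x xr.
  by rewrite normrZ ger0_norm ?sqrtr_ge0// ler_wpM2l ?sqrtr_ge0// SB.
- by move=> u v; rewrite dotZl dotZr Ssym.
- by move=> u; rewrite dotZl mulr_ge0 ?sqrtr_ge0.
- move=> x; have S0 : S 0 = 0.
    by have := Slin (-1) 0 0; rewrite scaler0 addr0 scaleN1r addNr.
  have SZ a u : S (a *: u) = a *: S u.
    by have := Slin a u 0; rewrite S0 !addr0.
  rewrite SZ SS scalerA -expr2 sqr_sqrtr ?ltW//= opprB addrC subrK.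
  by rewrite scalerA mulfV ?scale1r// gt_eqF.
Qed.

Notation S := (operator_sqrt dot R).

Lemma sqr_norm_operator_sqrt x : `|S x| ^+ 2 = dot (R x) x.
Proof. by have [_ _ Ssym _ SS] := operator_sqrtP; rewrite (sqr_norm Hnorm) -Ssym SS. Qed.

Lemma operator_sqrt_sub x y : S (x - y) = S x - S y.
Proof.
have [Slin _ _ _ _] := operator_sqrtP.
by have := Slin (-1) y x; rewrite !scaleN1r [- y + x]addrC [- S y + _]addrC.
Qed.

Lemma operator_sqrt_scale a x : S (a *: x) = a *: S x.
Proof.
have [Slin _ _ _ _] := operator_sqrtP.
have S0 : S 0 = 0 by rewrite -(subrr 0) operator_sqrt_sub !subrr.
by have := Slin a x 0; rewrite S0 !addr0.
Qed.

(** The solution of [R u = x] is the fixed point of the Richardson iteration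
[u - M^-1 (R u - x)], a contraction with ratio [sqrt (1 - a / M)]. *)
Lemma positive_lower_bound_surjective :
  positive_lower_bound dot R -> forall x, exists z, R z = x.
Proof.
move=> [a a0 Ra] x; have [M M0 RM] := (bounded_operatorP R).1 Rbnd.
pose f := fun u => (u - M^-1 *: R u) + M^-1 *: x.
have fl u v : f u - f v = (u - v) - M^-1 *: R (u - v).
  rewrite /f linearB scalerBr [in LHS]opprD addrACA subrr addr0.
  by rewrite !opprD addrACA.
(* In the zero space [1 - M^-1 * a] can be negative, hence the maximum. *)
pose q := Num.sqrt (Num.max 0 (1 - M^-1 * a)).
have q0 : 0 <= q by exact: sqrtr_ge0.
have q1 : q < 1.
  rewrite -sqrtr1 ltr_sqrt// gt_max ltr01/= gtrDl oppr_lt0.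
  by rewrite mulr_gt0// invr_gt0.
have flip u v : `|f u - f v| <= q * `|u - v|.
  rewrite -(@ler_pXn2r _ 2)// ?nnegrE// ?mulr_ge0// fl.
  apply: le_trans (id_sub_psd_norm_le Hnorm _ M0 Rsym Rpsd RM) _.
  rewrite exprMn sqr_sqrtr ?le_max ?lexx//.
  have : 1 - M^-1 * a <= Num.max 0 (1 - M^-1 * a) by rewrite le_max lexx orbT.
  move=> /(ler_wpM2r (sqr_ge0 `|u - v|)); apply: le_trans.
  by rewrite mulrBl mul1r lerB// -mulrA ler_wpM2l// invr_ge0 ltW.
pose g : {fun [set: H] >-> [set: H]} :=
  HB.pack f (isFun.Build _ _ setT setT f (fun _ _ => I)).
have [|||u _ fu] := @banach_fixed_point K H setT g.
- exists (NngNum q0); split=> // -[u v] _ /=; exact: flip.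
- exact: closedT.
- by exists 0.
exists u; apply: (@scalerI _ _ M^-1); first by rewrite invr_eq0 gt_eqF.
have : u + 0 = u + (- (M^-1 *: R u) + M^-1 *: x) by rewrite addr0 addrA.
by move=> /addrI/esym/eqP; rewrite addrC subr_eq0 => /eqP.
Qed.

(** If [S] is onto, the functionals [dot v] with [`|S v| <= 1] are pointwise
bounded, since at [S z] they equal [dot (S v) z]. By the uniform boundedness
principle the vectors [v] themselves are bounded, which is a lower bound for
[S]. *)
Lemma surjective_positive_lower_bound :
  (forall x, exists z, S z = x) -> positive_lower_bound dot R.
Proof.
move=> Sonto; have [Slin Sbnd Ssym Spsd SS] := operator_sqrtP.
pose F : set (H -> K) := [set f | exists2 v, `|S v| <= 1 & f = dot v].
have [C FC] : exists M, forall f, F f -> forall x, `|x| <= 1 -> `|f x| <= M.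
  apply: (@Banach_Steinhauss K H K F).
  - move=> _ [v _ ->]; split; last by move=> a x y; rewrite dotDr dotZr.
    move=> r; exists (`|v| * r) => x xr.
    by rewrite (le_trans (dot_le_norm Hnorm _ _))// ler_wpM2l.
  - move=> x; have [z <-] := Sonto x; exists `|z| => _ [v Sv ->].
    by rewrite -Ssym (le_trans (dot_le_norm Hnorm _ _))// ler_piMl.
have vC v : `|S v| <= 1 -> `|v| <= `|C| + 1.
  move=> Sv; have [->|v0] := eqVneq v 0; first by rewrite normr0 addr_ge0.
  have := FC (dot v) (ex_intro2 _ _ v Sv erefl) (`|v|^-1 *: v).
  rewrite normrZ normfV normr_id mulVf ?normr_eq0// dotZr -(sqr_norm Hnorm) => /(_ (lexx _)).
  rewrite expr2 mulrA mulVf ?normr_eq0// mul1r normr_id => /le_trans; apply.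
  by rewrite (le_trans (ler_norm _))// lerDl.
have D0 : 0 < `|C| + 1 by rewrite ltr_wpDl.
have SC v : `|v| <= (`|C| + 1) * `|S v|.
  have [Sv0|Sv0] := eqVneq (S v) 0; last first.
    have := vC (`|S v|^-1 *: v).
    rewrite operator_sqrt_scale !normrZ normfV normr_id mulVf ?normr_eq0//.
    by move=> /(_ (lexx _)); rewrite ler_pdivrMl ?normr_gt0// mulrC.
  rewrite Sv0 normr0 mulr0 leNgt; apply/negP => v0.
  (* All multiples of a kernel vector are in the family, even one whose norm is
     twice the bound. *)
  have := vC (((`|C| + 1) * 2 / `|v|) *: v).
  rewrite operator_sqrt_scale Sv0 scaler0 normr0 => /(_ ler01).
  have n0 : 0 <= (`|C| + 1) * 2 / `|v|.
    by rewrite divr_ge0 ?mulr_ge0 ?(ltW D0).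
  rewrite normrZ ger0_norm// divfK ?gt_eqF//.
  lra.
exists ((`|C| + 1) ^- 2) => [|u]; first by rewrite invr_gt0 exprn_gt0.
rewrite -sqr_norm_operator_sqrt ler_pdivrMl ?exprn_gt0// -exprMn.
by rewrite ler_pXn2r ?SC ?nnegrE// mulr_ge0// ltW.
Qed.

End Operator.
End SquareRoot.

(** * Positive integrals and sets of positive measure *)

Section MeasureAndIntegral.
Local Open Scope ereal_scope.
Import HBNNSimple.

(** The set where [f] is positive may fail to be measurable, so [A] is taken to be
the set where a simple function below [f], of positive integral, is positive. *)
Lemma integral_gt0_exists_set d (T : measurableType d) (K : realType)
    (mu : {measure set T -> \bar K}) (f : T -> \bar K) :
  (forall x, 0 <= f x) -> 0 < \int[mu]_x f x ->
  exists A, [/\ measurable A, 0 < mu A & forall x, A x -> 0 < f x].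
Proof.
move=> f0; rewrite ge0_integralTE// => /ereal_sup_gt[_ [h hf <-] h_gt0].
exists (h @^-1` `]0%R, +oo[); split.
- by rewrite -[X in measurable X]setTI; apply: measurable_funP.
- rewrite lt0e measure_ge0 andbT; apply/eqP => A0.
  move: h_gt0; rewrite sintegralE fsbig1 ?ltxx// => _ [x _ <-].
  have [hx0|hx0] := eqVneq (h x) 0%R; first by rewrite hx0 mul0e.
  rewrite (_ : mu _ = 0) ?mule0//; apply/eqP; rewrite eq_le measure_ge0 andbT.
  rewrite -A0 le_measure ?inE//.
  + by rewrite -[X in measurable X]setTI; apply: measurable_funP.
  + move=> z /= ->; rewrite in_itv /= andbT lt_def hx0 /=.
    exact: fun_ge0.
- by move=> x /=; rewrite in_itv /= andbT -lte_fin => /lt_le_trans; apply.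
Qed.

Lemma integral_gt0 d (T : measurableType d) (K : realType)
    (mu : {measure set T -> \bar K}) (f : T -> \bar K) (A : set T) (c : K) :
  (forall x, 0 <= f x) -> measurable A -> 0 < mu A -> (0 < c)%R ->
  (forall x, A x -> c%:E <= f x) -> 0 < \int[mu]_x f x.
Proof.
move=> f0 mA A0 c0 cf; rewrite ge0_integralTE//.
apply: (@lt_le_trans _ _ (c%:E * mu A)); first by rewrite mule_gt0.
apply: ereal_sup_ubound; exists (scale_nnsfun (indic_nnsfun K mA) (ltW c0)).
  move=> x /=; rewrite /measurable_realfun.mindic indicE; case: (boolP (x \in A)) => [|_].
    by rewrite inE /= mulr1 => /cf.
  by rewrite /= mulr0.
by rewrite sintegralrM /= sintegral_indic.
Qed.

(** At most [n.+1] disjoint sets have probability at least [n.+1%:R^-1]. *)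
Lemma countable_disjoint_pos d (T : measurableType d) (K : realType)
    (mu : probability T K) (I : choiceType) (A : I -> set T) :
  (forall i, measurable (A i)) -> trivIset setT A ->
  countable [set i | 0 < mu (A i)].
Proof.
move=> mA tA; pose J n := [set i | (n.+1%:R^-1)%:E <= mu (A i)].
have finJ n : finite_set (J n).
  apply: contrapT => /(infinite_set_fset n.+2)[B BJ nB].
  have finB := finite_fset B.
  have : mu (\bigcup_(i in [set` B]) A i) <= 1.
    by apply: probability_le1; apply: fin_bigcup_measurable.
  rewrite measure_fin_bigcup//; last exact: sub_trivIset tA.
  apply/negP; rewrite -ltNge.
  apply: (@lt_le_trans _ _ (\sum_(i \in [set` B]) (n.+1%:R^-1)%:E)); last first.
    by apply: lee_fsum => // i /BJ.
  rewrite -fsbig_seq ?fset_uniq// sumEFin lte_fin big_const_seq.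
  by rewrite count_predT iter_addr_0 -[ltRHS]mulr_natl ltr_pdivlMr// mul1r ltr_nat.
apply: (@sub_countable _ _ _ (\bigcup_n J n)); last first.
  by apply: bigcup_countable => // n _; exact: finite_set_countable.
apply: subset_card_le => i /=; move=> Ai0.
have [r r0 rA] : exists2 r : K, (0 < r)%R & r%:E <= mu (A i).
  exists (fine (mu (A i))); last by rewrite fineK// fin_num_measure.
  by rewrite fine_gt0// Ai0 ltey_eq fin_num_measure.
have [n] := ltr_add_invr r0; rewrite add0r => nr.
by exists n => //; rewrite /J /= (le_trans _ rA)// lee_fin ltW.
Qed.

Lemma uncountable_real (K : realType) : ~ countable [set: K].
Proof.
move=> /countable_lebesgue_measure0 h.
have : lebesgue_measure (`[0%R, 1%R] : set K) <= lebesgue_measure [set: K].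
  by apply: le_measure; rewrite ?inE.
by rewrite h lebesgue_measure_itv /= lte_fin ltr01 oppr0 adde0 lee_fin ler10.
Qed.

(** The balls of integer radius cover the space, so they cannot all be null. *)
Lemma pos_measure_ball (K : realType) (H : normedModType K)
  (mu : probability (borel H) K) :
  exists2 r : K, measurable (ball (0 : H)%R r : set (borel H)) & 0 < mu (ball (0 : H)%R r).
Proof.
have mB (r : K) : measurable (ball (0 : H)%R r : set (borel H)).
  apply: sub_sigma_algebra; exact: ball_open.
apply: contrapT => h.
have : mu.-negligible (\bigcup_n (ball (0 : H)%R n%:R)).
  apply: negligible_bigcup => n; apply/negligibleP => //.
  apply/eqP; rewrite eq_le measure_ge0 andbT leNgt; apply/negP => h'.
  by apply: h; exists n%:R.
rewrite (_ : \bigcup_n _ = setT).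
  move=> /(negligibleP _ measurableT) h0; have := probability_setT mu.
  by rewrite h0 => /esym/eqP; rewrite onee_eq0.
apply/seteqP; split=> // x _; exists (Num.truncn `|x|).+1 => //.
by rewrite -ball_normE /= sub0r normrN truncnS_gt.
Qed.
End MeasureAndIntegral.

Theorem theorem7 (K : realType) (H : completeNormedModType K)
    (dot : {dot H for idfun}) (Hnorm : norm_from_inner dot)
    (Hsep : separable H) (Hinf : infinite_dimensional H)
    (muf : probability (borel H) K) (mf : H) (Pf : {linear H -> H})
    (Hmuf : is_gaussian dot muf mf Pf)
    (R : {linear H -> H}) (Rbnd : bounded_fun_norm R)
    (Rsym : symmetric_operator dot R) (Rpsd : positive_semidefinite dot R)
    (PRcomm : forall x : H, Pf (R x) - R (Pf x) = 0) :
  (forall y : H,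
     (0 < \int[muf]_x expeR (- (2^-1)%:E * weighted_sqnorm dot R (y - x)%R))%E)
  <-> positive_lower_bound dot R.
Proof.
split=> [int_gt0|Rlb y].
  apply: surjective_positive_lower_bound => // v.
  apply: contrapT => vS.
  (* For each [t], a set of positive measure inside the coset of [t *: v]. *)
  have /choice[A AP] (t : K) : exists A : set (borel H), [/\ measurable A,
      (0 < muf A)%E & forall x, A x -> range (operator_sqrt dot R) (t *: v - x)].
    have [A [mA A0 AS]] :=
      integral_gt0_exists_set (fun=> expeR_ge0 _) (int_gt0 (t *: v)).
    exists A; split=> // x /AS; apply: contraPP => xS.
    rewrite /weighted_sqnorm ifF; last exact/negbTE/negP/(contra_not _ xS)/set_mem.
    by rewrite lt0_muley ?lte_fin ?oppr_lt0 ?invr_gt0//= ltxx.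
  have tA : trivIset setT A.
    apply/trivIsetP => s t _ _ st; apply/seteqP; split=> // x [].
    have [_ _ h] := AP s; have [_ _ h'] := AP t; move=> /h[z _ zs] /h'[w _ wt].
    apply: vS; exists ((s - t)^-1 *: (z - w)).
    rewrite operator_sqrt_scale// operator_sqrt_sub// zs wt opprB.
    rewrite addrA subrK -scalerBl scalerA mulVf ?scale1r//.
    by rewrite subr_eq0.
  apply: (@uncountable_real K).
  have mA t : measurable (A t) by have [] := AP t.
  have := countable_disjoint_pos muf mA tA.
  by congr countable; apply/seteqP; split=> // t _ /=; have [] := AP t.
have [a a0 Ra] := Rlb.
have [r mB B0] := pos_measure_ball muf.
pose c := expR (- 2^-1 * (a^-1 * (`|y| + r) ^+ 2)).
apply: (integral_gt0 (c := c) _ mB B0); [by move=> x; exact: expeR_ge0|exact: expR_gt0|].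
move=> x; rewrite -ball_normE /= sub0r normrN => xr.
have xS : range (operator_sqrt dot R) (y - x).
  have [u Ru] := positive_lower_bound_surjective Hnorm Rbnd Rsym Rpsd Rlb (y - x).
  have [_ _ _ _ SS] := operator_sqrtP Hnorm Rbnd Rsym Rpsd.
  by exists (operator_sqrt dot R u) => //; rewrite SS.
rewrite /weighted_sqnorm ifT ?inE//.
have Sle z : a * `|z| ^+ 2 <= `|operator_sqrt dot R z| ^+ 2.
  by rewrite (sqr_norm_operator_sqrt Hnorm).
set w := operator_invsqrt dot R (y - x).
have Sw : operator_sqrt dot R w = y - x.
  have [z _ Sz] := xS.
  (* [S] is injective, so that the preimage has minimal norm for free. *)
  have ex : exists z, operator_sqrt dot R z = y - x /\
    forall w, operator_sqrt dot R w = y - x -> `|z| <= `|w|.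
    exists z; split=> // w' Sw'.
    suff -> : z = w' by [].
    apply/subr0_eq/normr0_eq0/eqP; rewrite -sqrf_eq0 eq_le sqr_ge0 andbT.
    rewrite -(pmulr_rle0 _ a0) (le_trans (Sle _))//.
    by rewrite operator_sqrt_sub// Sz Sw' subrr normr0 expr0n.
  by have [] := xgetPex 0 ex.
rewrite -(sqr_norm Hnorm) /= lee_fin ler_expR !mulNr lerN2 ler_pM2l ?invr_gt0//.
rewrite ler_pdivlMl// (le_trans (Sle _))// Sw.
have r0 : 0 <= r by rewrite (le_trans _ (ltW xr)).
rewrite ler_pXn2r ?nnegrE ?addr_ge0// (le_trans (ler_normB _ _))//.
by rewrite lerD2l ltW.
Qed.
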